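(* Let $\mathcal E$ be an invertible noise map on $n$-qubit operators with $\mathcal E^{-1}=\sum_{\mathcal B\in\mathbb B}Q_{\mathcal B}\,\mathcal B$, where $\mathbb B$ is a finite set of linear maps (basis channels) and $Q_{\mathcal B}\in\mathbb R$. Partition $\mathbb B$ into subsets $\mathbb B_1,\dots,\mathbb B_T$ such that basis channels in the same subset share the same $\mathbb Z$-rows, choose an arbitrary representative $\mathcal B_t\in\mathbb B_t$ for each $t$, and define the compressed inverse $$\mathcal E'^{-1}=\sum_{t=1}^TQ'_{\mathcal B_t}\,\mathcal B_t,\qquad Q'_{\mathcal B_t}=\sum_{\mathcal B\in\mathbb B_t}Q_{\mathcal B}.$$ Then $\mathcal M_{\mathbb Z}\,\mathcal E'^{-1}\,\mathcal E=\mathcal M_{\mathbb Z}$, i.e. the noise $\mathcal E$ is completely canceled, and the sampling costs satisfy $\gamma'\le\gamma$, where $\gamma'=\sum_{t=1}^T|Q'_{\mathcal B_t}|$ and $\gamma=\sum_{\mathcal B\in\mathbb B}|Q_{\mathcal B}|$.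
   Context: Linear maps on operators on $(\mathbb C^2)^{\otimes n}$ are identified with their Pauli transfer matrices (matrices in the orthonormal basis of normalized Pauli operators $P/\sqrt{2^n}$, $P\in\{I,X,Y,Z\}^{\otimes n}$, for the Hilbert–Schmidt inner product); juxtaposition is composition. $\Pi_{\mathbb Z}$ is the orthogonal projector onto the span of $\{I,Z\}^{\otimes n}$ and $\Pi_\perp=\mathbb I-\Pi_{\mathbb Z}$. The computational-basis measurement channel $\mathcal M_{\mathbb Z}=\sum_{b\in\{0,1\}^n}|b\rangle\rangle\langle\langle b|$ (with $|b\rangle\rangle$ the vectorization of $|b\rangle\langle b|$) equals $\Pi_{\mathbb Z}$. Two maps $\mathcal B,\mathcal B'$ share the same $\mathbb Z$-rows if $\Pi_{\mathbb Z}\mathcal B\Pi_{\mathbb Z}+\Pi_{\mathbb Z}\mathcal B\Pi_\perp=\Pi_{\mathbb Z}\mathcal B'\Pi_{\mathbb Z}+\Pi_{\mathbb Z}\mathcal B'\Pi_\perp$. The symbol $\mathcal E'^{-1}$ is simply the name of the map defined by the displayed sum. *)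

(* Defs.v *)
From HB Require Import structures.
From mathcomp Require Import all_boot all_order all_algebra.
From mathcomp Require Import finmap complex.
From mathcomp Require Import reals.

Set Implicit Arguments.
Unset Strict Implicit.
Unset Printing Implicit Defensive.

Import Order.TTheory GRing.Theory Num.Theory.
Local Open Scope ring_scope.
Local Open Scope complex_scope.
Local Open Scope sesquilinear_scope.

(* The standard basis of (C^2)^{(x) n} is {0,1}^n; operators are matrices whose
   k-th row/column is the one labelled by the bit string [enum_val k]. *)
Definition bits (n : nat) := {ffun 'I_n -> 'I_2}.

Definition op (R : realType) (n : nat) := 'M[R[i]]_#|{: bits n}|.

(* Linear maps on n-qubit operators. Pauli transfer matrices are the matrices
   of these maps in an orthonormal basis, so every identity between transfer
   matrices below is the corresponding identity in 'End(op R n). *)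
Notation superop R n := 'End(op R n).

Section QubitOperators.

Variables (R : realType) (n : nat).
Implicit Types (A B X Y : op R n) (U : {vspace op R n}).

Definition hs A B : R[i] := \tr (A ^t* *m B).

Fact hs_is_linear A : linear (hs A : op R n -> R[i]^o).
Proof. by move=> a B B'; rewrite /hs mulmxDr -scalemxAr mxtraceD mxtraceZ. Qed.

HB.instance Definition _ A :=
  GRing.isLinear.Build R[i] (op R n) R[i]^o _ (hs A : op R n -> R[i]^o)
    (hs_is_linear A).

(* The functional <<A|. *)
Definition sbra A : 'Hom(op R n, R[i]^o) := linfun (hs A : op R n -> R[i]^o).

(* The rank-one map |A>><<B|. *)
Definition outer A B : superop R n := linfun (fun X : op R n => hs B X *: A).

Definition orthv U : {vspace op R n} :=
  (\bigcap_(i < \dim U) lker (sbra (vbasis U)`_i))%VS.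

Definition orth_proj U : superop R n := daddv_pi U (orthv U).

Definition pauliZ : 'M[R[i]]_2 := diag_mx (\row_(j < 2) (-1) ^+ j).

(* The tensor product of the n single-qubit operators [A q]. *)
Definition tensor_op (A : 'I_n -> 'M[R[i]]_2) : op R n :=
  \matrix_(k, l) \prod_(q < n) A q ((enum_val k : bits n) q)
                                   ((enum_val l : bits n) q).

Definition IZ_string (z : {ffun 'I_n -> bool}) : op R n :=
  tensor_op (fun q => if z q then pauliZ else 1%:M).

Definition PiZ : superop R n :=
  orth_proj <<[seq IZ_string z | z : {ffun 'I_n -> bool}]>>%VS.

Definition PiPerp : superop R n := \1%VF - PiZ.

(* |b><b| as an operator *)
Definition proj_bits (b : bits n) : op R n :=
  delta_mx (enum_rank b) (enum_rank b).

Definition MZ : superop R n :=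
  \sum_(b : bits n) outer (proj_bits b) (proj_bits b).

Definition same_Zrows (B B' : superop R n) : Prop :=
  (PiZ \o B \o PiZ)%VF + (PiZ \o B \o PiPerp)%VF =
  (PiZ \o B' \o PiZ)%VF + (PiZ \o B' \o PiPerp)%VF.

Lemma outerE A B X : outer A B X = hs B X *: A.
Proof.
have lin : linear (fun X : op R n => hs B X *: A).
  by move=> a Y Z; rewrite (hs_is_linear B) scalerDl scalerA.
pose g := GRing.isLinear.Build _ _ _ _ _ lin.
pose f : {linear op R n -> op R n} := HB.pack (fun X : op R n => hs B X *: A) g.
exact: (lfunE f).
Qed.

Lemma hs_lincomb_l m (a : 'I_m -> R[i]) (Y : 'I_m -> op R n) X :
  hs (\sum_i a i *: Y i) X = \sum_i (a i)^*%R * hs (Y i) X.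
Proof.
rewrite /hs !raddf_sum /= mulmx_suml raddf_sum; apply: eq_bigr => i _.
by rewrite linearZ /= map_mxZ -scalemxAl mxtraceZ.
Qed.

Lemma hs_eq0 X : hs X X = 0 -> X = 0.
Proof.
move=> /eqP; rewrite /hs /mxtrace => h.
have E k : (X ^t* *m X) k k = \sum_l `|X l k| ^+ 2.
  by rewrite mxE; apply: eq_bigr => l _; rewrite !mxE mulrC -normCK.
move: h; under eq_bigr do rewrite E.
rewrite psumr_eq0 => [/allP h|k _]; last by apply: sumr_ge0 => *; rewrite exprn_ge0.
apply/matrixP => l k; rewrite mxE.
have := h k (mem_index_enum _); rewrite psumr_eq0 => [/allP /(_ l (mem_index_enum _))|*].
  by rewrite sqrf_eq0 normr_eq0 => /eqP.
exact: exprn_ge0.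
Qed.

Lemma memv_orthv U X :
  reflect (forall Y, Y \in U -> hs Y X = 0) (X \in orthv U).
Proof.
apply: (iffP idP) => [|h].
  rewrite /orthv memvE; move/subv_bigcapP => h Y YU.
  rewrite (coord_vbasis YU) hs_lincomb_l big1 // => i _.
  have := h i isT; rewrite -memvE memv_ker lfunE /= => /eqP ->.
  by rewrite mulr0.
rewrite memvE; apply/subv_bigcapP => i _.
rewrite -memvE memv_ker lfunE /=; apply/eqP/h.
by apply/vbasis_mem/memt_nth.
Qed.

Lemma orthv_disjoint U : (U :&: orthv U)%VS = 0%VS.
Proof.
apply/eqP; rewrite -subv0; apply/subvP => X /memv_capP [XU /memv_orthv XO].
by rewrite memv0; apply/eqP/hs_eq0/XO.
Qed.

Lemma orthv_full U : (U + orthv U = fullv)%VS.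
Proof.
have cap1 (W : {vspace op R n}) (f : 'Hom(op R n, R[i]^o)) :
    (\dim W <= (\dim (W :&: lker f)).+1)%N.
  rewrite -(limg_ker_dim f W) -[X in (_ <= X)%N]addn1 leq_add2l.
  by rewrite (leq_trans (dimvS (subvf _))) // dimvf.
have capk k (f : 'I_k -> 'Hom(op R n, R[i]^o)) :
    (\dim {: op R n} <= \dim (\bigcap_(i < k) lker (f i))%VS + k)%N.
  elim: k f => [|k IHk] f; first by rewrite big_ord0 addn0.
  rewrite big_ord_recr /= addnS -addSn.
  by rewrite (leq_trans (IHk (fun i => f (widen_ord (leqnSn k) i)))) ?leq_add2r.
apply/eqP; rewrite eqEdim subvf /= dimv_disjoint_sum ?orthv_disjoint //.
by rewrite addnC capk.
Qed.

Lemma orth_projP U X :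
  orth_proj U X \in U /\ forall Y, Y \in U -> hs Y (X - orth_proj U X) = 0.
Proof.
split; first exact: memv_pi.
apply/memv_orthv.
have <- : daddv_pi (orthv U) U X = X - orth_proj U X.
  apply/eqP; rewrite eq_sym subr_eq addrC; apply/eqP/esym.
  by rewrite daddv_pi_add ?orthv_disjoint // orthv_full memvf.
exact: memv_pi.
Qed.

End QubitOperators.

(* Main.v *)
Require Import Defs.
From mathcomp Require Import all_boot all_order all_algebra.
From mathcomp Require Import finmap complex.
From mathcomp Require Import reals.
From mathcomp Require Import ring.

Import Order.TTheory GRing.Theory Num.Theory.
Local Open Scope ring_scope.
Local Open Scope complex_scope.

(* Since [PiZ + PiPerp] is the identity, sharing the Z-rows means that
   [PiZ \o B] is the same map throughout a class. Each |b><b| lies in the span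
   of {I,Z}^n, so [MZ = MZ \o PiZ] is also constant on classes, and replacing
   every B by its representative does not change [MZ \o E^-1]. The bound on
   the cost is the triangle inequality within each class. *)

Lemma sum_fset_partition (K : choiceType) (V : nmodType) (m : nat)
    (P : 'I_m -> {fset K}) (F : K -> V) :
  (forall s t : 'I_m, s != t -> [disjoint P s & P t]%fset) ->
  \sum_(x <- (\bigcup_(t in 'I_m) P t)%fset) F x =
  \sum_(t < m) \sum_(x <- P t) F x.
Proof.
(* [I] is the whole index type as a finite set, the form in which the lemma on disjoint unions takes
   its indices. *)
move=> Pdisj; pose I := [fset t | t in 'I_m]%fset.
have permI : perm_eq I (index_enum 'I_m).
  by apply: uniq_perm; rewrite ?index_enum_uniq // => t;
     rewrite mem_index_enum !inE.
rewrite (eq_bigl xpredT) // -(perm_big _ permI).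
rewrite partition_disjoint_bigfcup => [|s t _ _]; last exact: Pdisj.
exact: perm_big.
Qed.

Section ZMeasurement.

Variables (R : realType) (n : nat).
Implicit Types (X : op R n) (B : superop R n) (b : bits n).

(* |c><c| = (I + (-1)^c Z) / 2, multiplied out over the qubits. *)
Lemma proj_bits_IZ b :
  proj_bits R b = \sum_(z : {ffun 'I_n -> bool})
    (\prod_(q < n) ((-1) ^+ (z q * b q) / 2)) *: IZ_string R z.
Proof.
apply/matrixP => k l; rewrite summxE.
(* [A q e] is what qubit [q] contributes to the entry at [k], [l] when [z q = e]; distributivity
   then turns the sum over strings into a product of one-qubit sums. *)
pose A (q : 'I_n) (e : bool) : R[i] := (-1) ^+ (e * b q) / 2 *
  (if e then pauliZ R else 1%:M)
    ((enum_val k : bits n) q) ((enum_val l : bits n) q).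
transitivity (\sum_(z : {ffun 'I_n -> bool}) \prod_q A q (z q)); last first.
  apply: eq_bigr => z _; rewrite !mxE -big_split /=.
  by apply: eq_bigr => q _; rewrite /A; case: (z q).
rewrite -(bigA_distr_bigA A) /=.
have sumA q : \sum_e A q e =
    (((enum_val k : bits n) q == b q) && ((enum_val l : bits n) q == b q))%:R.
  rewrite big_bool /A !mxE mul1n mul0n expr0.
  have two0 : 2 != 0 :> R[i] by rewrite pnatr_eq0.
  (* The one-qubit identity is checked on all eight values of the three bits. *)
  move: ((enum_val k : bits n) q) ((enum_val l : bits n) q) (b q).
  by do 3! [case; case=> [|[|//]] ?]; rewrite -!val_eqE /=; field.
under eq_bigr => q _ do rewrite sumA.
have prod_eq (k' : 'I_#|{: bits n}|) :
    (k' == enum_rank b) = [forall q, (enum_val k' : bits n) q == b q].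
  rewrite -(inj_eq enum_val_inj) enum_rankK.
  by apply/eqP/forallP => [-> // | kb]; apply/ffunP => q; apply/eqP.
rewrite mxE !prod_eq.
case: andP => [[/forallP kb /forallP lb]|klb].
  by rewrite big1 // => q _; rewrite kb lb.
apply/esym/eqP/prodf_eq0; have : ~~ [forall q,
    ((enum_val k : bits n) q == b q) && ((enum_val l : bits n) q == b q)].
  apply: contra_notN klb => /forallP klb.
  by split; apply/forallP => q; case/andP: (klb q).
by case/forallPn => q /negbTE klq; exists q; rewrite ?klq.
Qed.

Lemma mem_proj_bits b :
  proj_bits R b \in
    <<[seq IZ_string R z | z : {ffun 'I_n -> bool}]>>%VS.
Proof.
rewrite proj_bits_IZ; apply: memv_suml => z _; apply/memvZ/memv_span.
exact: image_f.
Qed.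

Lemma MZ_PiZ : (MZ R n \o PiZ R n)%VF = MZ R n.
Proof.
apply/lfunP => X; rewrite comp_lfunE !sum_lfunE; apply: eq_bigr => b _.
(* The residue of [X] under [PiZ] is orthogonal to [proj_bits R b], so [X] and its projection have
   the same coefficient there. *)
have [_ /(_ _ (mem_proj_bits b)) orthX] :=
  orth_projP <<[seq IZ_string R z | z : {ffun 'I_n -> bool}]>>%VS X.
rewrite !outerE; congr (_ *: _); apply/esym/eqP; rewrite -subr_eq0.
by rewrite -orthX [X in _ == X]raddfB.
Qed.

Lemma MZ_same_Zrows B B' : same_Zrows B B' -> (MZ R n \o B = MZ R n \o B')%VF.
Proof.
have rows (C : superop R n) :
    (PiZ R n \o C \o PiZ R n)%VF + (PiZ R n \o C \o PiPerp R n)%VF =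
    (PiZ R n \o C)%VF.
  by rewrite -comp_lfunDr /PiPerp addrC subrK comp_lfun1r.
by rewrite /same_Zrows !rows -MZ_PiZ -!comp_lfunA => ->.
Qed.

End ZMeasurement.

Theorem proposition3 (R : realType) (n : nat)
    (E : superop R n) (BB : {fset superop R n}) (Q : superop R n -> R)
    (T : nat) (BBt : 'I_T -> {fset superop R n}) (Bt : 'I_T -> superop R n)
    (E_invertible : bijective E)
    (E_inverse : (E^-1)%VF = \sum_(B <- BB) (Q B)%:C *: B)
    (BBt_disjoint : forall s t : 'I_T, s != t -> [disjoint BBt s & BBt t]%fset)
    (BBt_cover : (\bigcup_(t in 'I_T) BBt t)%fset = BB)
    (BBt_Zrows : forall t B B',
       B \in BBt t -> B' \in BBt t -> same_Zrows B B')
    (Bt_repr : forall t, Bt t \in BBt t) :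
  let Q' t := \sum_(B <- BBt t) Q B in
  let E'inv := \sum_(t < T) (Q' t)%:C *: Bt t in
  let gamma := \sum_(B <- BB) `|Q B| in
  let gamma' := \sum_(t < T) `|Q' t| in
  (MZ R n \o E'inv \o E)%VF = MZ R n /\ gamma' <= gamma.
Proof.
move=> Q' E'inv gamma gamma'; split; last first.
  rewrite /gamma -BBt_cover sum_fset_partition //.
  by apply: ler_sum => t _; apply: ler_norm_sum.
(* A trivial kernel makes [E^-1] a genuine left inverse, so [E] cancels on the right. *)
have kerE : lker E == 0%VS by apply/lker0P/bij_inj.
suff -> : (MZ R n \o E'inv = MZ R n \o E^-1)%VF by rewrite lker0_compfVK.
rewrite E_inverse -BBt_cover sum_fset_partition //.
move: (MZ R n) (@MZ_same_Zrows R n) => M M_same_Zrows.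
apply/lfunP => X; rewrite !comp_lfunE !sum_lfunE !raddf_sum /=.
apply: eq_bigr => t _.
(* Expanding the class weight gives one copy of [Bt t] per member [B], each with weight [Q B], to be
   matched with [B] term by term. *)
rewrite /Q' (raddf_sum (real_complex R)) scaler_suml !sum_lfunE !raddf_sum /=.
apply: eq_big_seq => B BinBt.
have /M_same_Zrows/lfunP/(_ X) := BBt_Zrows t _ _ (Bt_repr t) BinBt.
by rewrite !comp_lfunE !scale_lfunE !linearZ /= => ->.
Qed.
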